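(* Let $g\in\mathcal{L}$ and, for $\lambda\in[0,1]$, let $f_\lambda$ be the representing function of the $\lambda$-weighted operator mean $\sigma_g$. Then for every $x\in(0,\infty)$, $$\left.\frac{\partial}{\partial\lambda}f_\lambda(x)\right|_{\lambda=0}=g(x),$$ where the derivative at $\lambda=0$ is the (one-sided) derivative of $\lambda\mapsto f_\lambda(x)$ on $[0,1]$.
   Context: A real-valued function $g$ on $(0,\infty)$ is operator monotone if $B\le A$ implies $g(B)\le g(A)$ for all self-adjoint bounded operators $A,B$ on a Hilbert space with spectra in $(0,\infty)$ (for every Hilbert space). $\mathcal{L}$ denotes the set of all operator monotone functions $g$ on $(0,\infty)$ with $g(1)=0$ and $g'(1)=1$. For $g\in\mathcal{L}$ and $\lambda\in[0,1]$, the representing function $f_\lambda:(0,\infty)\to(0,\infty)$ of the $\lambda$-weighted operator mean $\sigma_g$ is defined by letting $f_\lambda(x)$ be the unique $y>0$ with $$(1-\lambda)\,g\left(\frac{1}{y}\right)+\lambda\, g\left(\frac{x}{y}\right)=0 .$$ (In particular $f_0(x)=1$ and $f_1(x)=x$.) *)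

(* Defs.v *)
From HB Require Import structures.
From mathcomp Require Import all_boot all_order all_algebra.
From mathcomp Require Import all_classical all_reals all_analysis.
From mathcomp Require Import complex.

Set Implicit Arguments.
Unset Strict Implicit.
Unset Printing Implicit Defensive.

Import Order.TTheory GRing.Theory Num.Theory.
Import numFieldNormedType.Exports.

Local Open Scope classical_set_scope.
Local Open Scope complex_scope.
Local Open Scope ring_scope.

(* The inner product is linear in its first argument and conjugate-linear in
   its second one. *)
Record hilbertSpace (R : realType) := HilbertSpace {
  hcarrier :> completeNormedModType R[i] ;
  hdot : {dot hcarrier for Num.conj} ;
  hdot_norm : forall x : hcarrier, hdot x x = `|x| ^+ 2 }.

Section operators.
Context {R : realType} {H : hilbertSpace R}.
Implicit Types A B T : {linear H -> H}.

Definition bounded_op A := exists M : R[i], forall x : H, `|A x| <= M * `|x|.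

Definition selfadjoint A := forall x y : H, hdot H (A x) y = hdot H x (A y).

(* In the partial order of [R[i]], [z <= w] means that [w - z] is a
   nonnegative real number. *)
Definition op_le B A := forall x : H, hdot H (B x) x <= hdot H (A x) x.

Definition spectrum A : set R[i] := [set z | ~ exists S : {linear H -> H},
  [/\ bounded_op S,
      forall x : H, S (A x - z *: x) = x &
      forall x : H, A (S x) - z *: S x = x]].

Definition op_poly (p : {poly R}) A (x : H) : H :=
  \sum_(k < size p) (p`_k)%:C *: iter k A x.

(* [T = g(A)] in the continuous functional calculus of a bounded self-adjoint
   operator [A]: [T] is the operator-norm limit of [p_n(A)] for real
   polynomials [p_n] converging to [g] uniformly on the (real) spectrum of [A].
   Such a [T] exists exactly when [g] is continuous on the spectrum of [A]; in
   particular it always exists when the space is finite-dimensional. *)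
Definition funcalc (g : R -> R) A T := exists p : nat -> {poly R},
  (forall e : R, 0 < e -> \forall n \near \oo,
     forall r : R, spectrum A r%:C -> `|(p n).[r] - g r| <= e) /\
  (forall e : R, 0 < e -> \forall n \near \oo,
     forall x : H, `|op_poly (p n) A x - T x| <= e%:C * `|x|).

End operators.

(* Functions on (0, oo) are represented by total functions whose values outside
   of (0, oo) are irrelevant.  No continuity is assumed: as matrices are
   included, operator monotonicity in this sense implies continuity on (0, oo),
   so that [g(A)] and [g(B)] always exist for such a [g]. *)
Definition operator_monotone {R : realType} (g : R -> R) : Prop :=
  forall (H : hilbertSpace R) (A B gA gB : {linear H -> H}),
    bounded_op A -> bounded_op B ->
    selfadjoint A -> selfadjoint B ->
    spectrum A `<=` [set z | 0 < z] -> spectrum B `<=` [set z | 0 < z] ->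
    funcalc g A gA -> funcalc g B gB ->
    op_le B A -> op_le gB gA.

Definition classL {R : realType} : set (R -> R) :=
  [set g | [/\ operator_monotone g, g 1 = 0 & is_derive (1 : R) (1 : R) g 1]].

(* The unique [y > 0] with [(1 - l) g(1/y) + l g(x/y) = 0], for [g] in [classL],
   [l] in [0, 1] and [x > 0]; the default value 1 of [xget] is then not used. *)
Definition repr_fun {R : realType} (g : R -> R) (l x : R) : R :=
  xget 1 [set y | 0 < y /\ (1 - l) * g (1 / y) + l * g (x / y) = 0].

(* Main.v *)
Require Import Defs.
From HB Require Import structures.
From mathcomp Require Import all_boot all_order all_algebra.
From mathcomp Require Import all_classical all_reals all_analysis.
From mathcomp Require Import complex ring lra.

Set Implicit Arguments.
Unset Strict Implicit.
Unset Printing Implicit Defensive.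

Import Order.TTheory GRing.Theory Num.Theory.
Import numFieldNormedType.Exports.

Local Open Scope classical_set_scope.
Local Open Scope ring_scope.

(** Operator monotonicity enters only through two-by-two matrices.  Given
    [0 < s], [0 < t] and [p > (s + t) / 2], the symmetric matrix with
    eigenvectors [(1, 1)] and [(1, -1)] for the eigenvalues [s] and [t] has the
    mean [(s + t) / 2] as its upper left entry, so it lies below the diagonal
    matrix [diag(p, q)] as soon as [q] is large.  Applying [g] to both matrices
    and comparing upper left entries gives [(g s + g t) / 2 <= g p]
    ([operator_monotone_mean_le]).  This midpoint inequality says at once that
    [g] is nondecreasing (take [s = t]) and almost midpoint concave; for a
    monotone function the latter excludes jumps, so [g] is continuous on the
    half-line ([operator_monotone_continuous]).

    Since [g 1 = 0] and [g] has slope [1] at [1], monotonicity makes [g]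
    negative before [1] and positive after it, and the intermediate value
    theorem yields a solution [y] of the defining equation of the mean.  Put
    [z = 1 / y] and let [phi z = g z / (z - 1)] be the difference quotient at
    [1] ([slope1]).  The equation reads
    [(1 - h) * phi z * (z - 1) = - h * g (x * z)], that is
      [(y - 1) / h = g (x * z) / (z * (1 - h) * phi z)]
    ([repr_fun_slope]).  As [h] tends to [0], [z] tends to [1]
    ([repr_fun_inv_cvg]), so [phi z] tends to [1] and, by continuity of [g] at
    [x], the right-hand side tends to [g x]. *)

(** * The complex Euclidean plane as a Hilbert space *)

Section euclidean_plane.
Local Open Scope complex_scope.
Local Open Scope ring_scope.
Variable R : realType.

(** An alias, because the product of two normed modules already carries the
    supremum norm; [R[i]^o] is [R[i]] seen as a vector space over itself. *)
Definition cplane : Type := (R[i]^o * R[i]^o)%type.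

HB.instance Definition _ := Vector.copy cplane (R[i]^o * R[i]^o)%type.

Definition cplane_dot (u v : cplane) : R[i] :=
  u.1 * Num.conj v.1 + u.2 * Num.conj v.2.

Lemma cplane_dot_bilinear :
  bilinear_for *%R (Num.conj \; *%R) cplane_dot.
Proof.
split=> [v a u u'|u a v v'] /=; rewrite /cplane_dot /=.
  by rewrite !mulrDl mulrDr !mulrA addrACA.
by rewrite !rmorphD !rmorphM /= !mulrDr addrACA !(mulrCA _ (Num.conj a)).
Qed.

HB.instance Definition _ := @bilinear_isBilinear.Build
  R[i] cplane cplane R[i] *%R (Num.conj \; *%R) cplane_dot cplane_dot_bilinear.

Lemma cplane_dot_hermitian (u v : cplane) :
  cplane_dot u v = (-1) ^+ false * Num.conj (cplane_dot v u).
Proof.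
by rewrite expr0 mul1r /cplane_dot rmorphD !rmorphM /= !conjCK; congr +%R;
  rewrite mulrC.
Qed.

HB.instance Definition _ := isHermitianSesquilinear.Build
  R[i] cplane false Num.conj cplane_dot cplane_dot_hermitian.

Lemma cplane_dotE (u : cplane) :
  cplane_dot u u = `|u.1| ^+ 2 + `|u.2| ^+ 2.
Proof. by rewrite /cplane_dot !normCK. Qed.

Lemma cplane_dot_gt0 (u : cplane) : u != 0 -> 0 < cplane_dot u u.
Proof.
move=> u0; rewrite cplane_dotE lt_def addr_ge0 ?exprn_ge0// andbT.
apply: contra u0; rewrite paddr_eq0 ?exprn_ge0// !expf_eq0 /= !normr_eq0.
by case: u => a b /= /andP[/eqP-> /eqP->].
Qed.

HB.instance Definition _ := isDotProduct.Build
  R[i] cplane cplane_dot cplane_dot_gt0.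

Definition cplane_norm (u : cplane) : R[i] := sqrtC (cplane_dot u u).

Lemma cplane_normD (u v : cplane) :
  cplane_norm (u + v) <= cplane_norm u + cplane_norm v.
Proof. exact: (triangle_lerif (cplane_dot : {dot cplane for Num.conj}) u v). Qed.

Lemma cplane_normZ (a : R[i]) (u : cplane) :
  cplane_norm (a *: u) = `|a| * cplane_norm u.
Proof.
rewrite /cplane_norm (dnormZ (cplane_dot : {dot cplane for Num.conj})).
by rewrite rootCMl ?exprn_ge0// sqrCK.
Qed.

Lemma cplane_norm0_eq0 (u : cplane) : cplane_norm u = 0 -> u = 0.
Proof.
move/eqP; rewrite (sqrt_dnorm_eq0 (cplane_dot : {dot cplane for Num.conj})).
by move/eqP.
Qed.

HB.instance Definition _ := Lmodule_isNormed.Build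
  R[i] cplane cplane_normD cplane_normZ cplane_norm0_eq0.

Lemma cplane_norm_sqr (u : cplane) : cplane_dot u u = `|u| ^+ 2.
Proof. by rewrite [`|u|]/(cplane_norm u) sqrtCK. Qed.

Lemma cplane_le_norm1 (u : cplane) : `|u.1| <= `|u|.
Proof.
rewrite -ler_sqr ?nnegrE//= -cplane_norm_sqr cplane_dotE.
by rewrite lerDl exprn_ge0.
Qed.

Lemma cplane_le_norm2 (u : cplane) : `|u.2| <= `|u|.
Proof.
rewrite -ler_sqr ?nnegrE//= -cplane_norm_sqr cplane_dotE.
by rewrite lerDr exprn_ge0.
Qed.

Lemma cplane_norm_le (u : cplane) : `|u| <= `|u.1| + `|u.2|.
Proof.
rewrite -ler_sqr ?nnegrE ?addr_ge0//= -cplane_norm_sqr cplane_dotE.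
by rewrite sqrrD lerD2r lerDl mulrn_wge0// mulr_ge0.
Qed.

Lemma normc_ge_Im (z : R[i]) : `|complex.Im z|%:C <= `|z|.
Proof.
by rewrite normc_def lecR -sqrtr_sqr ler_wsqrtr// lerDr sqr_ge0.
Qed.

Lemma normc_le_ReIm (z : R[i]) : `|z| <= (`|complex.Re z| + `|complex.Im z|)%:C.
Proof.
rewrite normc_def lecR -[leRHS]ger0_norm ?addr_ge0// -sqrtr_sqr ler_wsqrtr//.
by rewrite sqrrD !real_normK ?num_real// lerD2r lerDl mulrn_wge0// mulr_ge0.
Qed.

(** Reduces completeness of the plane to that of the real line: a real function
    which does not increase distances maps Cauchy filters to Cauchy ones.  It is
    applied to the four real coordinates. *)
Lemma cauchy_contraction (F : set_system cplane) (f : cplane -> R) :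
  ProperFilter F -> cauchy F ->
  (forall u v, `|f u - f v|%:C <= `|u - v|) ->
  exists l : R, forall e, 0 < e -> \forall u \near F, `|l - f u| < e.
Proof.
move=> FF /cauchy_ballP Fc f_contr.
have /cauchy_cvg/cvg_ex[l fl] : cauchy (f @ F).
  apply/cauchy_ballP => e e0.
  have /Fc[[A B] /= [FA FB] AB] : 0 < e%:C by rewrite ltcR.
  exists (f @` A, f @` B) => /=.
    by split; [apply: filterS FA | apply: filterS FB] => u Au; exists u.
  move=> [_ _] /= [[u Au <-] [v Bv <-]].
  have := AB (u, v) (conj Au Bv); rewrite -ball_normE /= => uv.
  by rewrite -ball_normE /= -ltcR (le_lt_trans (f_contr u v)).
by exists l; move/cvgrPdist_lt: fl.
Qed.

Lemma cplane_complete (F : set_system cplane) :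
  ProperFilter F -> cauchy F -> cvg F.
Proof.
move=> FF Fc.
have [a fa] : exists l : R, forall e, 0 < e ->
    \forall u \near F, `|l - complex.Re (u : cplane).1| < e.
  apply: cauchy_contraction => // u v.
  by rewrite -raddfB (le_trans (normc_ge_Re _))// (cplane_le_norm1 (u - v)).
have [b fb] : exists l : R, forall e, 0 < e ->
    \forall u \near F, `|l - complex.Im (u : cplane).1| < e.
  apply: cauchy_contraction => // u v.
  by rewrite -raddfB (le_trans (normc_ge_Im _))// (cplane_le_norm1 (u - v)).
have [c fc] : exists l : R, forall e, 0 < e ->
    \forall u \near F, `|l - complex.Re (u : cplane).2| < e.
  apply: cauchy_contraction => // u v.
  by rewrite -raddfB (le_trans (normc_ge_Re _))// (cplane_le_norm2 (u - v)).
have [d fd] : exists l : R, forall e, 0 < e ->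
    \forall u \near F, `|l - complex.Im (u : cplane).2| < e.
  apply: cauchy_contraction => // u v.
  by rewrite -raddfB (le_trans (normc_ge_Im _))// (cplane_le_norm2 (u - v)).
pose L : cplane := ((a +i* b)%C, (c +i* d)%C).
apply/cvg_ex; exists L; apply/cvgrPdist_lt => e e0.
have ereal : e = (complex.Re e)%:C by rewrite RRe_real// gtr0_real.
have e4 : 0 < complex.Re e / 4 by rewrite divr_gt0// -ltcR -ereal.
near=> u; apply: le_lt_trans (cplane_norm_le _) _.
apply: le_lt_trans (lerD (normc_le_ReIm _) (normc_le_ReIm _)) _.
rewrite -rmorphD ereal ltcR /=.
have : `|a - complex.Re u.1| < complex.Re e / 4 by near: u; exact: fa.
have : `|b - complex.Im u.1| < complex.Re e / 4 by near: u; exact: fb.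
have : `|c - complex.Re u.2| < complex.Re e / 4 by near: u; exact: fc.
have : `|d - complex.Im u.2| < complex.Re e / 4 by near: u; exact: fd.
by rewrite !raddfB /=; lra.
Unshelve. all: by end_near. Qed.

HB.instance Definition _ := Uniform_isComplete.Build cplane cplane_complete.

Definition cplane_hilbert : hilbertSpace R :=
  @HilbertSpace R cplane cplane_dot cplane_norm_sqr.

End euclidean_plane.

(** * Functional calculus of operators with two spectral values *)

Section two_level.
Local Open Scope complex_scope.
Local Open Scope ring_scope.
Variables (R : realType) (H : hilbertSpace R) (P : {linear H -> H}).
Hypothesis P_idem : forall x, P (P x) = P x.
Hypothesis P_sa : selfadjoint P.

(** The operator with eigenvalue [s] on the range of the projection [P] and [t]
    on its kernel.  Complex [s] and [t] are allowed so that the resolvents of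
    such operators have the same form. *)
Definition two_level (s t : R[i]) (x : H) : H := s *: P x + t *: (x - P x).

Lemma two_level_linear s t : linear (two_level s t).
Proof.
move=> a x y; rewrite /two_level linearP opprD addrACA -scalerBr.
move: (x - P x) (y - P y) => x' y'.
by rewrite !scalerDr !scalerA !(mulrC a) addrACA.
Qed.

HB.instance Definition _ s t := GRing.isLinear.Build
  R[i] H H *:%R (two_level s t) (two_level_linear s t).

Lemma proj_two_level s t x : P (two_level s t x) = s *: P x.
Proof. by rewrite linearD !linearZ /= linearB /= P_idem subrr scaler0 addr0. Qed.

(** The maps [two_level s t] form a copy of the algebra of pairs [(s, t)];
    resolvents, powers and polynomials are computed in that algebra. *)
Lemma two_level_comp s t s' t' x :
  two_level s t (two_level s' t' x) = two_level (s * s') (t * t') x.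
Proof.
rewrite {1}/two_level proj_two_level {1}/two_level.
by rewrite addrAC subrr add0r !scalerA.
Qed.

Lemma two_level_scalar z x : two_level z z x = z *: x.
Proof. by rewrite /two_level -scalerDr addrC subrK. Qed.

Lemma two_levelB s t z x :
  two_level s t x - z *: x = two_level (s - z) (t - z) x.
Proof.
by rewrite -(two_level_scalar z) /two_level !scalerBl opprD addrACA.
Qed.

Lemma proj_orthogonal x : hdot H (P x) (x - P x) = 0.
Proof. by rewrite P_sa linearB /= P_idem subrr linear0r. Qed.

Lemma norm_proj_sqr x : `|x| ^+ 2 = `|P x| ^+ 2 + `|x - P x| ^+ 2.
Proof.
rewrite -!hdot_norm -(hnormDd (proj_orthogonal x)).
by rewrite addrC subrK.
Qed.

Lemma norm_proj_le x : `|P x| <= `|x|.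
Proof.
by rewrite -ler_sqr ?nnegrE//= [leRHS]norm_proj_sqr lerDl exprn_ge0.
Qed.

Lemma norm_coproj_le x : `|x - P x| <= `|x|.
Proof.
by rewrite -ler_sqr ?nnegrE//= [leRHS]norm_proj_sqr lerDr exprn_ge0.
Qed.

Lemma two_level_bounded s t : bounded_op (two_level s t).
Proof.
exists (`|s| + `|t|) => x; rewrite mulrDl.
rewrite (le_trans (ler_normD _ _))// !normrZ.
by rewrite lerD// ler_wpM2l// (norm_proj_le, norm_coproj_le).
Qed.

Lemma two_level_dot s t x y : hdot H (two_level s t x) y =
  s * hdot H (P x) y + t * (hdot H x y - hdot H (P x) y).
Proof. by rewrite linearDl !linearZl_LR /= linearBl. Qed.

Lemma two_level_selfadjoint (s t : R) : selfadjoint (two_level s%:C t%:C).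
Proof.
move=> x y; rewrite two_level_dot.
rewrite [RHS]linearDr !linearZr_LR /=
  (_ : hdot H x (y - P y) = hdot H x y - hdot H (P x) y).
  have realC (r : R) : r%:C \is Num.real by apply/complex_realP; exists r.
  by rewrite !conj_Creal// P_sa.
by rewrite P_sa; exact: linearBr.
Qed.

(** For [z] different from [s] and [t] the resolvent is
    [two_level (s - z)^-1 (t - z)^-1].  The inclusion may be strict, when [P]
    is [0] or the identity. *)
Lemma two_level_spectrum s t : spectrum (two_level s t) `<=` [set s; t].
Proof.
move=> z /= sp; apply: contrapT => /not_orP[zs zt]; apply: sp.
have sz : s - z != 0 by rewrite subr_eq0 eq_sym; apply/eqP.
have tz : t - z != 0 by rewrite subr_eq0 eq_sym; apply/eqP.
exists (two_level (s - z)^-1 (t - z)^-1); split.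
- exact: two_level_bounded.
- move=> x /=; rewrite two_levelB two_level_comp !mulVf//.
  by rewrite two_level_scalar scale1r.
- move=> x /=; rewrite two_levelB two_level_comp !mulfV//.
  by rewrite two_level_scalar scale1r.
Qed.

Lemma iter_two_level s t k x :
  iter k (two_level s t) x = two_level (s ^+ k) (t ^+ k) x.
Proof.
elim: k => [|k IHk]; first by rewrite !expr0 two_level_scalar scale1r.
by rewrite iterS IHk two_level_comp -!exprS.
Qed.

Lemma op_poly_two_level (p : {poly R}) (s t : R) x :
  op_poly p (two_level s%:C t%:C) x = two_level (p.[s])%:C (p.[t])%:C x.
Proof.
rewrite /op_poly !horner_coef !rmorph_sum /= /two_level !scaler_suml -big_split.
apply: eq_bigr => k _ /=; rewrite iter_two_level /two_level scalerDr !scalerA.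
by rewrite !rmorphM !rmorphXn.
Qed.

(** The spectrum has at most two points, so a polynomial of degree at most one
    agrees with [g] on it, and the constant sequence of that polynomial serves
    as the approximating sequence. *)
Lemma funcalc_two_level (g : R -> R) (s t : R) :
  funcalc g (two_level s%:C t%:C) (two_level (g s)%:C (g t)%:C).
Proof.
have [p ps pt] : exists2 p : {poly R}, p.[s] = g s & p.[t] = g t.
  have [<-|st] := eqVneq s t; first by exists (g s)%:P; rewrite hornerC.
  exists ((g s)%:P + ((g t - g s) / (t - s)) *: ('X - s%:P)).
    by rewrite !hornerE subrr mulr0 addr0.
  by rewrite !hornerE divfK ?subr_eq0 1?eq_sym// addrC subrK.
exists (fun=> p); split=> e e0; near=> n.
  move=> r /two_level_spectrum[] /complexI ->;
    by rewrite ?(ps, pt) subrr normr0 ltW.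
move=> x; rewrite op_poly_two_level ps pt subrr normr0 mulr_ge0//.
by rewrite ler0c ltW.
Unshelve. all: by end_near. Qed.

End two_level.

(** Operator monotonicity rephrased without spectra and functional calculus:
    on a comparable pair of two-level operators, [g] acts on the levels. *)
Lemma operator_monotone_two_level (R : realType) (g : R -> R)
    (H : hilbertSpace R) (P Q : {linear H -> H}) (p q s t : R) :
  operator_monotone g ->
  (forall x, P (P x) = P x) -> selfadjoint P ->
  (forall x, Q (Q x) = Q x) -> selfadjoint Q ->
  0 < p -> 0 < q -> 0 < s -> 0 < t ->
  op_le (two_level Q s%:C%C t%:C%C) (two_level P p%:C%C q%:C%C) ->
  op_le (two_level Q (g s)%:C%C (g t)%:C%C) (two_level P (g p)%:C%C (g q)%:C%C).
Proof.
move=> g_mon idP saP idQ saQ p0 q0 s0 t0 le_QP.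
have spectrum_gt0 (S : {linear H -> H}) (a b : R) :
    (forall x, S (S x) = S x) -> selfadjoint S -> 0 < a -> 0 < b ->
    spectrum (two_level S a%:C%C b%:C%C) `<=` [set z | 0 < z].
  move=> idS saS a0 b0 z /(two_level_spectrum idS saS)[] -> /=;
    by rewrite ltcR.
by apply: (g_mon H _ _ _ _ _ _ _ _ _ _ _ _ le_QP);
  [exact: two_level_bounded|exact: two_level_bounded
  |exact: two_level_selfadjoint|exact: two_level_selfadjoint
  |exact: spectrum_gt0|exact: spectrum_gt0
  |exact: funcalc_two_level|exact: funcalc_two_level].
Qed.

(** * The midpoint inequality *)

Section midpoint_inequality.
Local Open Scope complex_scope.
Local Open Scope ring_scope.
Variable R : realType.
Implicit Types (g : R -> R).

Let K := cplane_hilbert R.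

Definition fst_proj (u : K) : K := ((u : cplane R).1, 0).

Lemma fst_proj_linear : linear fst_proj.
Proof.
move=> a u v; have E : 0 = a * 0 + 0 by rewrite mulr0 addr0.
exact: (congr1 (pair (a * (u : cplane R).1 + (v : cplane R).1)) E).
Qed.

HB.instance Definition _ := GRing.isLinear.Build
  R[i] K K *:%R fst_proj fst_proj_linear.

Lemma fst_proj_idem u : fst_proj (fst_proj u) = fst_proj u.
Proof. by []. Qed.

Lemma fst_proj_selfadjoint : selfadjoint fst_proj.
Proof.
by move=> u v; rewrite /= /cplane_dot /= !mul0r rmorph0 mulr0.
Qed.

(** The orthogonal projection onto the line spanned by [(1, 1)]. *)
Definition mean_proj (u : K) : K :=
  let m := 2^-1 * ((u : cplane R).1 + (u : cplane R).2) in (m, m).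

Lemma mean_proj_linear : linear mean_proj.
Proof.
move=> a u v.
have E : 2^-1 * (a * (u : cplane R).1 + (v : cplane R).1 +
                 (a * (u : cplane R).2 + (v : cplane R).2)) =
    a * (2^-1 * ((u : cplane R).1 + (u : cplane R).2)) +
    2^-1 * ((v : cplane R).1 + (v : cplane R).2) :> R[i] by ring.
exact: (congr2 pair E E).
Qed.

HB.instance Definition _ := GRing.isLinear.Build
  R[i] K K *:%R mean_proj mean_proj_linear.

Lemma mean_proj_idem u : mean_proj (mean_proj u) = mean_proj u.
Proof. by congr pair => /=; field. Qed.

Lemma mean_proj_selfadjoint : selfadjoint mean_proj.
Proof.
move=> u v; rewrite /= /cplane_dot /= !rmorphM !rmorphD !fmorphV rmorph_nat.
ring.
Qed.

(** The left operator has the matrix with diagonal entries [m] and off-diagonal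
    entries [r * k]; the difference of the two quadratic forms at [(a, b)] is
    the perfect square [k * |a - r * b| ^ 2].  The lower right entry
    [m + r ^ 2 * k] of the right operator is the least one for which this
    difference is nonnegative. *)
Lemma op_le_mean_fst (m k r : R) : 0 <= k ->
  op_le (two_level mean_proj (m + r * k)%:C (m - r * k)%:C)
        (two_level fst_proj (m + k)%:C (m + r ^+ 2 * k)%:C).
Proof.
move=> k0 [a b]; rewrite !two_level_dot /= /cplane_dot /= -subr_ge0.
rewrite (_ : _ - _ = k%:C * `|a - r%:C * b| ^+ 2).
  by rewrite mulr_ge0 ?ler0c ?exprn_ge0.
have conjB : Num.conj (a - r%:C * b : R[i]) = Num.conj a - r%:C * Num.conj b.
  rewrite rmorphB rmorphM /=; congr (_ - _ * _).
  by rewrite conj_Creal//; apply/complex_realP; exists r.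
rewrite normCK conjB !rmorphD rmorphN !rmorphM /=.
by field.
Qed.

(** Compares the upper left entries of [g(B)] and [g(A)] for the matrices of
    [op_le_mean_fst], with eigenvalues [s], [t] and [p], [q].  The strict
    hypothesis leaves the room [k > 0] needed to dominate the off-diagonal
    entries [(s - t) / 2 = r * k]. *)
Lemma operator_monotone_mean_le g (s t p : R) : operator_monotone g ->
  0 < s -> 0 < t -> s + t < 2 * p -> (g s + g t) / 2 <= g p.
Proof.
move=> g_mon s0 t0 stp.
pose m := (s + t) / 2; pose k := p - m; pose r := (s - t) / 2 / k.
have k0 : 0 < k by rewrite /k /m; lra.
have q0 : 0 < m + r ^+ 2 * k.
  by rewrite ltr_pwDl ?divr_gt0 ?addr_gt0// mulr_ge0 ?sqr_ge0 ?ltW.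
have rk : r * k = (s - t) / 2 by rewrite divfK// gt_eqF.
have sE : m + r * k = s by rewrite rk /m; field.
have tE : m - r * k = t by rewrite rk /m; field.
have pE : m + k = p by rewrite addrC subrK.
have p0 : 0 < p by lra.
have := op_le_mean_fst m r (ltW k0); rewrite sE tE pE => le_QP.
have := operator_monotone_two_level g_mon fst_proj_idem fst_proj_selfadjoint
  mean_proj_idem mean_proj_selfadjoint p0 q0 s0 t0 le_QP.
move=> /(_ (1, 0)); rewrite !two_level_dot /= /cplane_dot /=.
rewrite rmorph0 rmorph1 !mulr0 !addr0 !mulr1 subrr mulr0 addr0.
rewrite [X in _ + _ * X](_ : _ = 2^-1); last by field.
have half : 2^-1 = (2^-1 : R)%:C by rewrite fmorphV rmorph_nat.
by rewrite -mulrDl -rmorphD half -rmorphM lecR.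
Qed.

End midpoint_inequality.

(** * Monotonicity and continuity *)

Section operator_monotone_regularity.
Variables (R : realType) (g : R -> R).
Hypothesis g_mon : operator_monotone g.

Lemma operator_monotone_le s t : 0 < s -> s <= t -> g s <= g t.
Proof.
move=> s0; rewrite le_eqVlt => /predU1P[->//|st].
have := operator_monotone_mean_le g_mon s0 s0 (p := t).
by rewrite mulrDl mul1r ltrD// => /(_ isT); lra.
Qed.

(** Let [L] be the left limit of [g] at [x] and choose [s < x] with
    [g s > L - e / 2].  A point [t] slightly to the right of [x] and [s] have
    their midpoint to the left of some [p < x], so that
    [g t <= 2 * g p - g s < L + e / 2]: on the whole interval from [s] to [t],
    [g] varies by less than [e]. *)
Lemma operator_monotone_continuous x : 0 < x -> {for x, continuous g}.
Proof.
move=> x0; pose E := g @` `]0, x[.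
have ubE : ubound E (g x).
  by move=> _ [y /= /[!in_itv]/= /andP[y0 yx] <-];
    rewrite operator_monotone_le// ltW.
have E0 : E !=set0.
  exists (g (x / 2)), (x / 2) => //=.
  by rewrite in_itv /=; apply/andP; split; lra.
have supE : has_sup E by split=> //; exists (g x).
apply/cvgrPdist_lt => e e0.
have e2 : 0 < e / 2 by rewrite divr_gt0.
have [_ [s /= /[!in_itv]/= /andP[s0 sx] <-] gs] := sup_adherent e2 supE.
(* s + t = 2 * x - 2 / 3 * (x - s) < 2 * x - 1 / 3 * (x - s) = 2 * p *)
pose t := x + (x - s) / 3; pose p := x - (x - s) / 6.
have gp : g p <= sup E.
  apply: sup_upper_bound => //; exists p => //=.
  by rewrite in_itv /= /p; apply/andP; split; lra.
have gst : (g s + g t) / 2 <= g p.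
  by apply: operator_monotone_mean_le => //; rewrite /t /p; lra.
have tx : x < t by rewrite /t; lra.
near=> y.
have ys : s < y by near: y; exact: lt_nbhsr.
have yt : y < t by near: y; exact: lt_nbhsl.
have : g s <= g y by rewrite operator_monotone_le// ltW.
have : g y <= g t by rewrite operator_monotone_le// ?ltW// (lt_trans s0).
have : g s <= g x by rewrite operator_monotone_le// ltW.
have : g x <= g t by rewrite operator_monotone_le// ltW.
by move: gst gs gp; rewrite ltr_norml => *; apply/andP; split; lra.
Unshelve. all: by end_near. Qed.

End operator_monotone_regularity.

(** * The representing function near weight zero *)

Section representing_function.
Variables (R : realType) (g : R -> R).
Hypothesis gL : classL g.

Let g_mon : operator_monotone g. Proof. by case: gL. Qed.
Let g1 : g 1 = 0. Proof. by case: gL. Qed.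

(** The difference quotient of [g] at [1], extended by its limit there, so that
    [slope1E] holds without exception and [slope1_cvg] can be composed with
    functions that may take the value [1]. *)
Definition slope1 z := if z == 1 then 1 else g z / (z - 1).

Lemma slope1E z : g z = slope1 z * (z - 1).
Proof.
rewrite /slope1; case: eqVneq => [->|z1]; first by rewrite g1 subrr mulr0.
by rewrite divfK// subr_eq0.
Qed.

Lemma slope1_cvg : slope1 z @[z --> (1 : R)] --> (1 : R).
Proof.
case: gL => _ _ [dg Dg]; apply/cvgrPdist_lt => e e0.
(* the difference quotient in the form used to define the derivative *)
have : h^-1 *: (g (h *: (1 : R) + 1) - g 1) @[h --> 0^'] --> (1 : R).
  by rewrite -[X in _ --> X]Dg; exact: dg.
move=> /cvgrPdist_lt /(_ e e0) /nbhs_ballP[d /= d0 dP].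
apply/nbhs_ballP; exists d => //= z; rewrite /ball /= => zd.
rewrite /slope1; case: eqVneq => [_|z1]; first by rewrite subrr normr0.
have := dP (z - 1); rewrite /ball /= sub0r normrN distrC subr_eq0.
rewrite /GRing.scale /= mulr1 subrK g1 subr0 mulrC; exact.
Qed.

(** Near [1] the sign of [g] is that of its slope; monotonicity carries it to
    the whole half-line. *)
Lemma classL_gt0 t : 1 < t -> 0 < g t.
Proof.
move=> t1.
have /cvgrPdist_lt/(_ 1 ltr01)/nbhs_ballP[d /= d0 dP] := slope1_cvg.
pose z := 1 + Num.min (d / 2) (t - 1).
have z1 : 1 < z by rewrite ltrDl lt_min divr_gt0//= subr_gt0.
have zt : z <= t by rewrite -lerBrDl ge_min lexx orbT.
have zd : z - 1 < d.
  by rewrite addrC addKr (@le_lt_trans _ _ (d / 2)) ?ge_min ?lexx//; lra.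
apply: (@lt_le_trans _ _ (g z)).
  rewrite slope1E mulr_gt0 ?subr_gt0//.
  have := dP z; rewrite /ball /= distrC gtr0_norm ?subr_gt0// => /(_ zd).
  by rewrite ltr_norml; lra.
by rewrite operator_monotone_le// (lt_trans ltr01).
Qed.

Lemma classL_lt0 t : 0 < t -> t < 1 -> g t < 0.
Proof.
move=> t0 t1.
have /cvgrPdist_lt/(_ 1 ltr01)/nbhs_ballP[d /= d0 dP] := slope1_cvg.
pose z := 1 - Num.min (d / 2) (1 - t).
have z1 : z < 1 by rewrite ltrBlDr ltrDl lt_min divr_gt0//= subr_gt0.
have zt : t <= z by rewrite lerBrDr -lerBrDl ge_min lexx orbT.
have zd : 1 - z < d.
  by rewrite opprB addrC subrK (@le_lt_trans _ _ (d / 2)) ?ge_min ?lexx//; lra.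
apply: (@le_lt_trans _ _ (g z)); first by rewrite operator_monotone_le.
rewrite slope1E pmulr_rlt0 ?subr_lt0//.
have := dP z; rewrite /ball /= gtr0_norm ?subr_gt0// => /(_ zd).
by rewrite ltr_norml; lra.
Qed.

Lemma classL_ge0 t : 1 <= t -> 0 <= g t.
Proof. by move=> t1; rewrite -g1 operator_monotone_le. Qed.

Lemma classL_le0 t : 0 < t -> t <= 1 -> g t <= 0.
Proof. by move=> t0 t1; rewrite -g1 operator_monotone_le. Qed.

Lemma repr_fun0 x : repr_fun g 0 x = 1.
Proof.
rewrite /repr_fun; case: xgetP => [y _ [y0]|//].
rewrite subr0 !mul1r mul0r addr0 => gy.
apply/eqP; rewrite -invr_eq1; apply: contra_eqT gy.
rewrite neq_lt => /orP[y1|y1]; first by rewrite lt_eqF// classL_lt0// invr_gt0.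
by rewrite gt_eqF// classL_gt0.
Qed.

(** The left-hand side is continuous in [y] and has opposite signs at [y = 1]
    and [y = x], where one of its two terms vanishes because [g 1 = 0]. *)
Lemma repr_fun_exists h x : 0 < h < 1 -> 0 < x ->
  exists y, 0 < y /\ (1 - h) * g (1 / y) + h * g (x / y) = 0.
Proof.
move=> /andP[h0 h1] x0.
have h1' : 0 <= 1 - h by rewrite subr_ge0 ltW.
pose F y := (1 - h) * g (1 / y) + h * g (x / y).
have F_cont y : 0 < y -> {for y, continuous F}.
  move=> y0; have yV : (fun y => y^-1) z @[z --> y] --> y^-1.
    by apply: cvgV; [rewrite gt_eqF|exact: cvg_id].
  apply: cvgD; apply: cvgM; try exact: cvg_cst.
    apply: (@cvg_comp _ _ _ (fun y => 1 / y) g _ (nbhs (1 / y))).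
      by apply: cvgM => //; exact: cvg_cst.
    by apply: operator_monotone_continuous; rewrite ?divr_gt0.
  apply: (@cvg_comp _ _ _ (fun y => x / y) g _ (nbhs (x / y))).
    by apply: cvgM => //; exact: cvg_cst.
  by apply: operator_monotone_continuous; rewrite ?divr_gt0.
have F1 : F 1 = h * g x by rewrite /F !divr1 g1 mulr0 add0r.
have Fx : F x = (1 - h) * g (1 / x) by rewrite /F divff ?gt_eqF// g1 mulr0 addr0.
have [x1|x1] := leP 1 x.
  have [||y] := @IVT _ F 1 x 0 x1.
  - apply: continuous_in_subspaceT => y; rewrite inE /= in_itv /= => /andP[y1 _].
    by apply: F_cont; rewrite (lt_le_trans ltr01).
  - rewrite F1 Fx ge_min le_max; apply/andP; split; apply/orP; [right|left].
      rewrite mulr_ge0_le0// classL_le0 ?divr_gt0//.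
      by rewrite ler_pdivrMr// mul1r.
    by rewrite mulr_ge0 ?classL_ge0// (ltW h0).
  - by rewrite in_itv /= => /andP[y1 _] Fy; exists y; split=> //; lra.
have [||y] := @IVT _ F x 1 0 (ltW x1).
- apply: continuous_in_subspaceT => y; rewrite inE /= in_itv /= => /andP[y1 _].
  by apply: F_cont; rewrite (lt_le_trans x0).
- rewrite F1 Fx ge_min le_max; apply/andP; split; apply/orP; [right|left].
    by rewrite mulr_ge0_le0 ?classL_le0 ?(ltW h0) ?(ltW x1).
  rewrite mulr_ge0// classL_ge0//.
  by rewrite ler_pdivlMr// mul1r ltW.
- by rewrite in_itv /= => /andP[y1 _] Fy; exists y; split=> //; lra.
Qed.

Lemma repr_fun_eq h x : 0 < h < 1 -> 0 < x -> 0 < repr_fun g h x /\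
  (1 - h) * g (repr_fun g h x)^-1 + h * g (x / repr_fun g h x) = 0.
Proof.
move=> h01 x0.
have [] := xgetPex 1 (repr_fun_exists h01 x0).
by rewrite -[xget _ _]/(repr_fun g h x) div1r.
Qed.

(** In a solution [g z] and [g (x * z)] have opposite signs, so [z] and [x * z]
    lie on different sides of [1]; hence [x * z] is between [1] and [x]. *)
Lemma solution_bound h x z : 0 < h < 1 -> 0 < x -> 0 < z ->
  (1 - h) * g z + h * g (x * z) = 0 -> `|g (x * z)| <= `|g x|.
Proof.
move=> /andP[h0 h1] x0 z0 E.
have h1' : 0 < 1 - h by rewrite subr_gt0.
have xz0 : 0 < x * z by rewrite mulr_gt0.
have [z1|z1|z1] := ltgtP z 1.
- have gxz : 0 < g (x * z).
    rewrite -(pmulr_rgt0 _ h0).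
    have : (1 - h) * g z < 0 by rewrite pmulr_rlt0// classL_lt0.
    lra.
  have le_xz : g (x * z) <= g x by rewrite operator_monotone_le// ger_pMr// ltW.
  by rewrite !ger0_norm// ?ltW// (lt_le_trans gxz).
- have gxz : g (x * z) < 0.
    rewrite -(pmulr_rlt0 _ h0).
    have : 0 < (1 - h) * g z by rewrite pmulr_rgt0// classL_gt0.
    lra.
  have le_xz : g x <= g (x * z) by rewrite operator_monotone_le// ler_pMr// ltW.
  by rewrite !ler0_norm ?lerN2// ?ltW// (le_lt_trans le_xz).
- by rewrite z1 mulr1.
Qed.

(** The equation and [solution_bound] give [|g z| <= 2 * h * |g x|] for
    [h <= 1 / 2], so [g z] tends to [0]; as [g] is monotone and nonzero away
    from [1], this forces [z] to tend to [1]. *)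
Lemma repr_fun_inv_cvg x : 0 < x ->
  (repr_fun g h x)^-1 @[h --> 0^'+] --> (1 : R).
Proof.
move=> x0; apply/cvgrPdist_lt => e e0.
(* The bound 1 / 2 keeps 1 - d inside the half-line. *)
pose d := Num.min e (1 / 2).
have d0 : 0 < d by rewrite lt_min e0; lra.
have d1 : d <= 1 / 2 by rewrite ge_min lexx orbT.
have de : d <= e by rewrite ge_min lexx.
have gp : 0 < g (1 + d) by rewrite classL_gt0// ltrDl.
have gm : g (1 - d) < 0 by rewrite classL_lt0//; lra.
pose m := Num.min (g (1 + d)) (- g (1 - d)).
have m0 : 0 < m by rewrite lt_min gp oppr_gt0.
have mp : m <= g (1 + d) by rewrite ge_min lexx.
have mm : m <= - g (1 - d) by rewrite ge_min lexx orbT.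
near=> h.
have h0 : 0 < h by [].
have h2 : h < 1 / 2 by near: h; apply: nbhs_right_lt; lra.
have hm : h < m / (2 * (`|g x| + 1)).
  by near: h; apply: nbhs_right_lt; rewrite divr_gt0// mulr_gt0// ltr_wpDl.
have h01 : 0 < h < 1 by rewrite h0 (lt_trans h2)//; lra.
have [y0 E] := repr_fun_eq h01 x0.
set z := (repr_fun g h x)^-1 in E *.
have z0 : 0 < z by rewrite invr_gt0.
have gz : `|g z| < m.
  have hg : (1 - h) * `|g z| <= h * `|g x|.
    have h1' : 0 <= 1 - h by lra.
    rewrite -[1 - h]ger0_norm// -normrM -normrN (addr0_eq E).
    rewrite normrM (gtr0_norm h0) ler_wpM2l ?(ltW h0)//.
    exact: (solution_bound h01 x0 z0 E).
  have : h * (2 * (`|g x| + 1)) < m.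
    by rewrite -ltr_pdivlMr// mulr_gt0// ltr_wpDl.
  have : 0 <= (1 / 2 - h) * `|g z| by rewrite mulr_ge0// subr_ge0 ltW.
  lra.
move: gz; rewrite ltr_norml => /andP[gz1 gz2].
have zlt : z < 1 + d.
  rewrite ltNge; apply/negP => zd.
  by have := operator_monotone_le g_mon (addr_gt0 ltr01 d0) zd; lra.
have zgt : 1 - d < z.
  rewrite ltNge; apply/negP => zd.
  by have := operator_monotone_le g_mon z0 zd; lra.
by rewrite ltr_norml; apply/andP; split; lra.
Unshelve. all: by end_near. Qed.

(** The defining equation solved for the difference quotient, written in
    [z = 1 / y]; every factor on the right has a limit as [h] tends to [0]. *)
Lemma repr_fun_slope h x : 0 < h < 1 -> 0 < x ->
  let z := (repr_fun g h x)^-1 in slope1 z != 0 ->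
  (repr_fun g h x - repr_fun g 0 x) / h =
  g (x * z) / (z * (1 - h) * slope1 z).
Proof.
move=> h01 x0 z s0; have [y0 E] := repr_fun_eq h01 x0.
case/andP: h01 => h0 h1.
rewrite repr_fun0; move: E; rewrite -/z slope1E => E.
have z0 : 0 < z by rewrite invr_gt0.
have -> : repr_fun g h x = z^-1 by rewrite invrK.
have -> : g (x * z) = - ((1 - h) * (slope1 z * (z - 1))) / h.
  by rewrite (addr0_eq E) (mulrC h) mulfK ?gt_eqF.
by field; rewrite s0 subr_eq0 !gt_eqF.
Qed.

End representing_function.

Theorem proposition2 (R : realType) (g : R -> R) (hg : classL g)
    (x : R) (hx : 0 < x) :
  (repr_fun g h x - repr_fun g 0 x) / h @[h --> 0^'+] --> g x.
Proof.
have z1 := repr_fun_inv_cvg hg hx.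
pose z h := (repr_fun g h x)^-1.
have xz : x * z h @[h --> 0^'+] --> x.
  by rewrite -[X in _ --> X]mulr1; apply: cvgM => //; exact: cvg_cst.
have gxz : g (x * z h) @[h --> 0^'+] --> g x.
  have g_mon : operator_monotone g by case: hg.
  exact: (cvg_comp _ _ xz (operator_monotone_continuous g_mon hx)).
have sz : slope1 g (z h) @[h --> 0^'+] --> (1 : R).
  exact: (cvg_comp _ _ z1 (slope1_cvg hg)).
have h0 : (1 - h) @[h --> (0 : R)^'+] --> (1 : R).
  rewrite -[X in _ --> X]subr0; apply: cvgB; first exact: cvg_cst.
  exact: cvg_within.
have : g (x * z h) / (z h * (1 - h) * slope1 g (z h)) @[h --> 0^'+] --> g x.
  have E : g x = g x / (1 * 1 * 1) by rewrite !mulr1 divr1.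
  rewrite [X in _ --> X]E.
  apply: cvgM => //; apply: cvgV; first by rewrite !mulr1 oner_neq0.
  by apply: cvgM => //; apply: cvgM.
apply: cvg_trans; apply: near_eq_cvg; near=> h.
rewrite /= repr_fun_slope//.
- by apply/andP; split => //; near: h; apply: nbhs_right_lt.
- have : `|1 - slope1 g (z h)| < 1.
    by near: h; move/cvgrPdist_lt: sz; apply; exact: ltr01.
  by apply: contraTneq => ->; rewrite subr0 normr1 ltxx.
Unshelve. all: by end_near. Qed.
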